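(* There exists a family of 3-SAT formulas $(F_N)_N$, where $F_N$ has $O(N^2/\log N)$ variables, such that \[ \beta_2(S(F_N))=2^{\Omega(N)}. \]
   Context: For a CNF formula $F$ on $n$ variables, the solution complex $S(F)$ is the cubical subcomplex of $\{0,1\}^n$ whose vertices are satisfying assignments and whose $k$-faces are axis-aligned $k$-dimensional subcubes all of whose $2^k$ vertices satisfy $F$. $\beta_2$ denotes the dimension of the second homology group over $\mathbb Z_2$. *)

(* Defs.v *)
From HB Require Import structures.
From mathcomp Require Import all_boot all_order all_algebra.

Set Implicit Arguments.
Unset Strict Implicit.
Unset Printing Implicit Defensive.

Import GRing.Theory.
Local Open Scope ring_scope.

Section CNF.
Variable n : nat.

(* The pair (i, true) is the literal x_i, and (i, false) its negation. *)
Definition literal := ('I_n * bool)%type.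
Definition clause := seq literal.
Definition cnf := seq clause.
Definition assignment := {ffun 'I_n -> bool}.

Definition sat_clause (x : assignment) (C : clause) : bool :=
  has (fun l : literal => x l.1 == l.2) C.

Definition sat (x : assignment) (F : cnf) : bool := all (sat_clause x) F.

Definition is_3cnf (F : cnf) : bool :=
  all (fun C : clause => (size C <= 3)%N) F.

(* An axis-aligned subcube of {0,1}^n: coordinate i is fixed to b when
   s i = Some b, and is free when s i = None. *)
Definition face := {ffun 'I_n -> option bool}.

Definition fdim (s : face) : nat := #|[set i | s i == None]|.

Definition vertex_of (x : assignment) (s : face) : bool :=
  [forall i, (s i == None) || (s i == Some (x i))].

(* t arises from s by fixing exactly one free coordinate. *)
Definition facet (t s : face) : bool :=
  [exists i, [&& s i == None, t i != None
               & [forall j, (j != i) ==> (t j == s j)]]].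

Definition in_solution_complex (F : cnf) (s : face) : bool :=
  [forall x, vertex_of x s ==> sat x F].

Lemma facetP (t s : face) :
  reflect (exists i, [/\ s i = None, t i <> None & forall j, j != i -> t j = s j])
          (facet t s).
Proof.
apply: (iffP existsP) => [[i /and3P[/eqP si /eqP ti /forallP h]]|[i [si ti h]]].
  by exists i; split=> // j ji; apply/eqP; move: (h j); rewrite ji.
exists i; apply/and3P; split; [exact/eqP | exact/eqP |].
by apply/forallP => j; apply/implyP => /h ->.
Qed.

Lemma facet_fdim (t s : face) : facet t s -> fdim s = (fdim t).+1.
Proof.
case/facetP => i [si ti h]; rewrite /fdim (cardsD1 i) inE si eqxx add1n.
congr _.+1; apply: eq_card => j; rewrite !inE.
by have [->|/h ->] := eqVneq j i; first by apply/esym/eqP.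
Qed.

Lemma facet_in_solution_complex (F : cnf) (t s : face) :
  facet t s -> in_solution_complex F s -> in_solution_complex F t.
Proof.
case/facetP => i [si ti h] /forallP Fs; apply/forallP => x; apply/implyP.
move=> /forallP xt; move: (Fs x) => /implyP; apply; apply/forallP => j.
by have [->|/h <-] := eqVneq j i; [rewrite si | exact: xt].
Qed.

End CNF.

Section Homology.
Variables (n : nat) (F : cnf n).

Definition cell (k : nat) :=
  {s : face n | (fdim s == k) && in_solution_complex F s}.

Definition chain (k : nat) := {ffun cell k -> ('F_2)^o}.

(* For k = 0 no cell of dimension k.-1 = 0 is a facet of a 0-cell, so the
   boundary out of degree 0 is the zero map. *)
Definition boundary_fun (k : nat) (c : chain k) : chain k.-1 :=
  [ffun t => \sum_(s : cell k | facet (val t) (val s)) c s].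

Lemma boundary_fun_is_linear k : linear (@boundary_fun k).
Proof.
move=> a c d; apply/ffunP => t; rewrite !ffunE scaler_sumr -big_split /=.
by apply: eq_bigr => s _; rewrite !ffunE.
Qed.

HB.instance Definition _ (k : nat) :=
  GRing.isLinear.Build 'F_2 (chain k) (chain k.-1) _ (@boundary_fun k)
    (@boundary_fun_is_linear k).

Definition boundary (k : nat) : 'Hom(chain k, chain k.-1) :=
  linfun (@boundary_fun k).

Definition cycles (k : nat) : {vspace chain k} := lker (boundary k).

Definition boundaries (k : nat) : {vspace chain k} := limg (boundary k.+1).

Lemma boundary_boundary k : (boundary k \o boundary k.+1 = 0)%VF.
Proof.
apply/lfunP => c; rewrite comp_lfunE !lfunE /=; apply/ffunP => t; rewrite !ffunE.
under eq_bigr do rewrite ffunE.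
rewrite (exchange_big_dep xpredT) //= big1 // => u _; rewrite sumr_const.
case: (pickP (fun s : cell k => facet (val t) (val s) && facet (val s) (val u)));
  last by move=> h; rewrite (eq_card (B := pred0)) ?card0 ?mulr0n.
move=> s0 /andP[ts0 s0u].
have /facetP[i [ui s0i hi]] := s0u; have /facetP[j [s0j tj hj]] := ts0.
have ij : j != i by apply: contra_notN s0i => /eqP <-.
have uj : val u j = None by rewrite -(hi j ij).
have ti : val t i = val s0 i by rewrite hj // eq_sym.
have ht l : l != i -> l != j -> val t l = val u l by move=> li lj; rewrite hj // hi.
pose s1 : face n := [ffun l => if l == j then val t j else val u l].
have s1i : s1 i = None by rewrite ffunE eq_sym (negPf ij).
have ts1 : facet (val t) s1.
  apply/facetP; exists i; split=> // [|l li]; first by rewrite ti.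
  by rewrite ffunE; have [->//|lj] := eqVneq l j; rewrite ht.
have s1u : facet s1 (val u).
  apply/facetP; exists j; split=> // [|l lj]; first by rewrite ffunE eqxx.
  by rewrite ffunE (negPf lj).
have s1P : (fdim s1 == k) && in_solution_complex F s1.
  have /andP[/eqP du Fu] := valP u.
  rewrite (facet_in_solution_complex s1u Fu) andbT.
  by rewrite -eqSS -(facet_fdim s1u) du.
pose s1' : cell k := Sub s1 s1P.
rewrite (eq_card (B := pred2 s0 s1')); last first.
  move=> s; rewrite !inE; apply/andP/idP => [[ts su]|/orP[]/eqP-> //].
  have /facetP[a [ua sa ha]] := su; have /facetP[b [sb tb hb]] := ts.
  have ab : b != a by apply: contra_notN sa => /eqP <-.
  have ub : val u b = None by rewrite -(ha b ab).
  have tsa : val t a = val s a by rewrite hb // eq_sym.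
  have in_ij l : val u l = None -> val t l <> None -> (l == i) || (l == j).
    by move=> ul tl; apply: contra_notT tl; rewrite negb_or => /andP[li lj]; rewrite ht.
  have /orP[/eqP ai|/eqP aj] : (a == i) || (a == j) by apply: in_ij; rewrite ?tsa.
    apply/orP; left; apply/eqP/val_inj/ffunP => l.
    have [->|li] := eqVneq l i; first by rewrite -ti -{1}ai -tsa ai.
    by rewrite ha ?ai // hi.
  apply/orP; right; apply/eqP/val_inj/ffunP => l; rewrite /= ffunE.
  have [->|lj] := eqVneq l j; first by rewrite -{1}aj -tsa aj.
  by rewrite ha ?aj.
have ns01 : s0 != s1' by apply: contra_notN s0i => /eqP ->.
rewrite card2 ns01.
by rewrite -mulr_natl pchar_Zp // mul0r.
Qed.

Lemma boundaries_sub_cycles k : (boundaries k <= cycles k)%VS.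
Proof.
apply/subvP => c /memv_imgP[d _ ->]; rewrite memv_ker.
by have /lfunP/(_ d) := boundary_boundary k; rewrite comp_lfunE zero_lfunE => ->.
Qed.

(* dim (cycles / boundaries); the subtraction is not truncated, by
   boundaries_sub_cycles. *)
Definition betti (k : nat) : nat := (\dim (cycles k) - \dim (boundaries k))%N.

End Homology.

(* Main.v *)
From HB Require Import structures.
Require Import Defs.
From mathcomp Require Import all_boot all_order all_algebra.
From mathcomp Require Import reals exp.
From mathcomp Require Import zify.

(** The solution complex of "the [n + 2] variables are not all equal" consists
    of the faces of the [(n + 2)]-cube that avoid two antipodal vertices.  It is
    an [n]-sphere: two points for [n = 0] and a hexagon for [n = 1].
    Conjunction on disjoint variables multiplies solution complexes, so [N]
    copies of the first and two copies of the second formula give [2 ^ N]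
    disjoint tori with only [2 N + 6] variables.  As there are no 3-cells, the
    fundamental classes of the tori are independent in [H_2]. *)

Set Implicit Arguments.
Unset Strict Implicit.
Unset Printing Implicit Defensive.

Import Order.TTheory GRing.Theory Num.Theory.
Local Open Scope ring_scope.

Lemma cards_sum_mem (T : finType) (A : {set T}) : #|A| = (\sum_x (x \in A))%N.
Proof. by rewrite -sum1_card big_mkcond; apply: eq_bigr => x _; case: (x \in A). Qed.

Section Cofaces.
Variables (n : nat) (F : cnf n).
Implicit Types (s t : face n) (i j : 'I_n).

Lemma fdim_cell d (u : cell F d) : fdim (val u) = d.
Proof. by have /andP[/eqP] := valP u. Qed.

Lemma cell_in_solution_complex d (u : cell F d) : in_solution_complex F (val u).
Proof. by have /andP[] := valP u. Qed.

Lemma cell_of_face d s :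
  in_solution_complex F s -> fdim s = d -> exists u : cell F d, val u = s.
Proof.
move=> sF /eqP ds; have sP : (fdim s == d) && in_solution_complex F s by rewrite ds.
by exists (Sub s sP).
Qed.

Definition free_at t i : face n := [ffun j => if j == i then None else t j].

Lemma facet_free_atP t s :
  reflect (exists2 i, t i != None & s = free_at t i) (facet t s).
Proof.
apply: (iffP (facetP t s)) => [[i [si ti st]] | [i ti ->]].
  exists i; first exact/eqP.
  by apply/ffunP => j; rewrite ffunE; case: eqVneq => [->|/st].
exists i; split; [by rewrite ffunE eqxx | exact/eqP |].
by move=> j ji; rewrite ffunE (negPf ji).
Qed.

Lemma free_at_inj t : {in [pred i | t i != None] &, injective (free_at t)}.
Proof.
move=> i j ti _ /ffunP/(_ i); rewrite !ffunE eqxx.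
by case: eqVneq => // _ ti0; rewrite inE -ti0 in ti.
Qed.

Definition coface_vars t : {set 'I_n} :=
  [set i | (t i != None) && in_solution_complex F (free_at t i)].

Lemma card_cofaces d t : (fdim t).+1 = d ->
  #|[pred s : cell F d | facet t (val s)]| = #|coface_vars t|.
Proof.
move=> dt; rewrite -(card_imset _ val_inj) -(card_in_imset (f := free_at t)); last first.
  by move=> i j; rewrite !inE => /andP[ti _] /andP[tj _]; apply: free_at_inj.
apply: eq_card => s; apply/imsetP/imsetP => [[u tu ->]|[i]].
  have /facet_free_atP[i ti ui] := tu; exists i => //.
  by rewrite inE ti -ui cell_in_solution_complex.
rewrite inE => /andP[ti Fi] ->.
have ft : facet t (free_at t i) by apply/facet_free_atP; exists i.
have [|u ui] := cell_of_face Fi (d := d); first by rewrite (facet_fdim ft).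
by exists u; rewrite // inE ui.
Qed.

End Cofaces.

Section BettiLowerBound.
Variables (n : nat) (F : cnf n) (d : nat).

(* The parity condition makes the sum of all d-cells a mod 2 cycle.  For t of
   dimension d it is automatic, as then t has no cofaces. *)
Definition mod2_closed : Prop :=
  (forall s, in_solution_complex F s -> (fdim s <= d)%N) /\
  (forall t, in_solution_complex F t -> (d <= (fdim t).+1)%N -> ~~ odd #|coface_vars F t|).

Definition locally_constant (T : Type) (p : face n -> T) : Prop :=
  forall t i, in_solution_complex F (free_at t i) -> p (free_at t i) = p t.

Definition onto_on_cells (T : Type) (p : face n -> T) : Prop :=
  forall a, exists s, [/\ in_solution_complex F s, fdim s = d & p s = a].

(* The fibres of p are m disjoint subcomplexes, each with a d-cell. *)
Definition splits_into (m : nat) : Prop :=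
  exists (T : finType) (p : face n -> T),
    [/\ #|T| = m, locally_constant p & onto_on_cells p].

Lemma splits_into1 s : in_solution_complex F s -> fdim s = d -> splits_into 1.
Proof.
move=> sF ds; exists unit, (fun=> tt); split=> //; first exact: card_unit.
by case; exists s.
Qed.

Lemma cofaces_even t : mod2_closed -> in_solution_complex F t ->
  ~~ odd #|[pred s : cell F d | facet t (val s)]|.
Proof.
move=> [_ evenF] tF; have [dt|dt] := eqVneq (fdim t).+1 d.
  by rewrite card_cofaces // evenF // dt.
rewrite eq_card0 // => s; rewrite !inE; apply: contra_neqF dt => /facet_fdim <-.
exact: fdim_cell.
Qed.

Lemma boundaries_eq0 : mod2_closed -> boundaries F d = 0%VS.
Proof.
move=> [dimF _]; apply/eqP; rewrite -subv0; apply/subvP => c /memv_imgP[e _ ->].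
rewrite (_ : e = 0) ?linear0 ?mem0v //; apply/ffunP => s.
by have := dimF _ (cell_in_solution_complex s); rewrite fdim_cell ltnn.
Qed.

Section FundamentalChains.
Variables (T : finType) (p : face n -> T).

Definition fundamental_chain (f : {ffun T -> ('F_2)^o}) : chain F d :=
  [ffun s => f (p (val s))].

Lemma fundamental_chain_is_linear : linear fundamental_chain.
Proof. by move=> k f g; apply/ffunP => s; rewrite !ffunE. Qed.

HB.instance Definition _ :=
  GRing.isLinear.Build 'F_2 {ffun T -> ('F_2)^o} (chain F d) _
    fundamental_chain fundamental_chain_is_linear.

Lemma fundamental_chain_inj : onto_on_cells p -> injective fundamental_chain.
Proof.
move=> p_onto f g /ffunP fg; apply/ffunP => a; have [s [sF ds <-]] := p_onto a.
by have [u <-] := cell_of_face sF ds; have := fg u; rewrite !ffunE.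
Qed.

Lemma fundamental_chain_cycle f :
  mod2_closed -> locally_constant p -> fundamental_chain f \in cycles F d.
Proof.
move=> Fclosed p_const; rewrite memv_ker lfunE /=; apply/eqP/ffunP => t; rewrite !ffunE.
rewrite (eq_bigr (fun=> f (p (val t)))) => [|s /facet_free_atP[i _ si]]; last first.
  by rewrite ffunE si p_const // -si cell_in_solution_complex.
have := cofaces_even Fclosed (cell_in_solution_complex t).
rewrite sumr_const -dvdn2 (dvdn_pcharf (pchar_Fp _)) // => /eqP even0.
by rewrite -mulr_natl even0 mul0r.
Qed.

End FundamentalChains.

Lemma betti_ge_splits m : mod2_closed -> splits_into m -> (m <= betti F d)%N.
Proof.
move=> Fclosed [T [p [<- p_const p_onto]]].
rewrite /betti boundaries_eq0 // dimv0 subn0.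
have ker0 : lker (linfun (fundamental_chain p)) == 0%VS.
  by apply/lker0P => f g; rewrite !lfunE; apply: fundamental_chain_inj.
have <- : \dim (limg (linfun (fundamental_chain p))) = #|T|.
  by rewrite limg_dim_eq ?(eqP ker0) ?capv0 // dimvf /dim /= muln1.
apply/dimvS/subvP => c /memv_imgP[f _ ->]; rewrite lfunE.
exact: fundamental_chain_cycle.
Qed.

End BettiLowerBound.

Section Renaming.
Variables (m n : nat) (f : 'I_m -> 'I_n).

Definition pullback (A : Type) (x : {ffun 'I_n -> A}) : {ffun 'I_m -> A} :=
  [ffun i => x (f i)].

Definition rename (F : cnf m) : cnf n := [seq [seq (f l.1, l.2) | l <- C] | C <- F].

Lemma sat_rename (x : assignment n) F : sat x (rename F) = sat (pullback x) F.
Proof.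
rewrite /sat all_map; apply: eq_all => C; rewrite /= /sat_clause has_map.
by apply: eq_has => l; rewrite /= ffunE.
Qed.

Lemma is_3cnf_rename F : is_3cnf (rename F) = is_3cnf F.
Proof. by rewrite /is_3cnf all_map; apply: eq_all => C; rewrite /= size_map. Qed.

Lemma pullback_free_at (t : face n) i :
  injective f -> pullback (free_at t (f i)) = free_at (pullback t) i.
Proof. by move=> f_inj; apply/ffunP => j; rewrite !ffunE (inj_eq f_inj). Qed.

Lemma pullback_free_at_out (t : face n) k :
  (forall i, f i != k) -> pullback (free_at t k) = pullback t.
Proof. by move=> fk; apply/ffunP => j; rewrite !ffunE (negPf (fk j)). Qed.

End Renaming.

Definition corner (n : nat) (b : bool) (s : face n) : assignment n :=
  [ffun i => odflt b (s i)].

Lemma corner_vertex n b (s : face n) : vertex_of (corner b s) s.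
Proof. by apply/forallP => i; rewrite ffunE; case: (s i) => //= c; rewrite eqxx. Qed.

Section Product.
Variables m n : nat.
Implicit Types (F : cnf m) (G : cnf n).

Local Notation lpart := (pullback (@lshift m n)).
Local Notation rpart := (pullback (@rshift m n)).

Definition join_ffun (A : Type) (x : {ffun 'I_m -> A}) (y : {ffun 'I_n -> A}) :
    {ffun 'I_(m + n) -> A} :=
  [ffun k => match split k with inl i => x i | inr j => y j end].

Lemma lpart_join (A : Type) (x : {ffun 'I_m -> A}) y : lpart (join_ffun x y) = x.
Proof. by apply/ffunP => i; rewrite !ffunE (unsplitK (inl i)). Qed.

Lemma rpart_join (A : Type) x (y : {ffun 'I_n -> A}) : rpart (join_ffun x y) = y.
Proof. by apply/ffunP => j; rewrite !ffunE (unsplitK (inr j)). Qed.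

Lemma cards_split_ord (P : pred 'I_(m + n)) :
  #|[set k | P k]| = (#|[set i | P (lshift n i)]| + #|[set j | P (rshift m j)]|)%N.
Proof. by rewrite -!sum1dep_card big_split_ord. Qed.

Lemma fdim_split (s : face (m + n)) : fdim s = (fdim (lpart s) + fdim (rpart s))%N.
Proof.
by rewrite /fdim cards_split_ord; congr (_ + _)%N; apply: eq_card => i; rewrite !inE ffunE.
Qed.

Lemma vertex_of_split (x : assignment (m + n)) (s : face (m + n)) :
  vertex_of x s = vertex_of (lpart x) (lpart s) && vertex_of (rpart x) (rpart s).
Proof.
apply/forallP/andP => [xs | [/forallP xl /forallP xr] k].
  by split; apply/forallP => i; rewrite !ffunE; apply: xs.
rewrite -[k]splitK; case: (split k) => i /=.
  by have := xl i; rewrite !ffunE.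
by have := xr i; rewrite !ffunE.
Qed.

Lemma lpart_free_atl (t : face (m + n)) i :
  lpart (free_at t (lshift n i)) = free_at (lpart t) i.
Proof. exact/pullback_free_at/lshift_inj. Qed.

Lemma rpart_free_atr (t : face (m + n)) j :
  rpart (free_at t (rshift m j)) = free_at (rpart t) j.
Proof. exact/pullback_free_at/rshift_inj. Qed.

Lemma lpart_free_atr (t : face (m + n)) j : lpart (free_at t (rshift m j)) = lpart t.
Proof. by apply: pullback_free_at_out => i; rewrite eq_lrshift. Qed.

Lemma rpart_free_atl (t : face (m + n)) i : rpart (free_at t (lshift n i)) = rpart t.
Proof. by apply: pullback_free_at_out => j; rewrite eq_rlshift. Qed.

Definition cnf_prod F G : cnf (m + n) :=
  rename (@lshift m n) F ++ rename (@rshift m n) G.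

Lemma is_3cnf_prod F G : is_3cnf F -> is_3cnf G -> is_3cnf (cnf_prod F G).
Proof. by move=> F3 G3; rewrite /is_3cnf all_cat -!/(is_3cnf _) !is_3cnf_rename F3. Qed.

Lemma in_solution_complex_prod F G s :
  in_solution_complex (cnf_prod F G) s =
  in_solution_complex F (lpart s) && in_solution_complex G (rpart s).
Proof.
have satE x : sat x (cnf_prod F G) = sat (lpart x) F && sat (rpart x) G.
  by rewrite -!sat_rename /sat all_cat.
apply/forallP/andP => [sFG|[/forallP sF /forallP sG] x]; last first.
  rewrite vertex_of_split satE; apply/implyP => /andP[xs ys].
  by rewrite (implyP (sF _) xs) (implyP (sG _) ys).
split; apply/forallP => x; apply/implyP => xs.
  have := sFG (join_ffun x (corner true (rpart s))).
  by rewrite vertex_of_split satE lpart_join rpart_join xs corner_vertex => /andP[].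
have := sFG (join_ffun (corner true (lpart s)) x).
by rewrite vertex_of_split satE lpart_join rpart_join xs corner_vertex => /andP[].
Qed.

Lemma card_coface_vars_prod F G t : in_solution_complex (cnf_prod F G) t ->
  #|coface_vars (cnf_prod F G) t| =
  (#|coface_vars F (lpart t)| + #|coface_vars G (rpart t)|)%N.
Proof.
rewrite in_solution_complex_prod => /andP[tF tG].
rewrite cards_split_ord; congr (_ + _)%N; apply: eq_card => i.
  by rewrite !inE in_solution_complex_prod lpart_free_atl rpart_free_atl tG andbT ffunE.
by rewrite !inE in_solution_complex_prod lpart_free_atr rpart_free_atr tF ffunE.
Qed.

Lemma mod2_closed_prod F G d e :
  mod2_closed F d -> mod2_closed G e -> mod2_closed (cnf_prod F G) (d + e).
Proof.
move=> [dimF evenF] [dimG evenG]; split=> [s|t tFG]; rewrite fdim_split.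
  by rewrite in_solution_complex_prod => /andP[/dimF sd /dimG se]; apply: leq_add.
rewrite card_coface_vars_prod //; move: tFG.
rewrite in_solution_complex_prod => /andP[tF tG] codim1.
have := dimF _ tF; have := dimG _ tG => le_e le_d.
by rewrite oddD (negPf (evenF _ tF _)) ?(negPf (evenG _ tG _)) //; lia.
Qed.

Lemma splits_into_prod F G d e k l :
  splits_into F d k -> splits_into G e l ->
  splits_into (cnf_prod F G) (d + e) (k * l).
Proof.
move=> [T [p [<- p_const p_onto]]] [U [q [<- q_const q_onto]]].
exists (T * U)%type, (fun s => (p (lpart s), q (rpart s))); split.
- exact: card_prod.
- move=> t i; rewrite -[i]splitK in_solution_complex_prod.
  case: (split i) => j /=.
    by rewrite lpart_free_atl rpart_free_atl => /andP[/p_const -> _].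
  by rewrite lpart_free_atr rpart_free_atr => /andP[_ /q_const ->].
- move=> [a b]; have [s [sF ds <-]] := p_onto a; have [t [tG dt <-]] := q_onto b.
  exists (join_ffun s t).
  by rewrite in_solution_complex_prod fdim_split lpart_join rpart_join sF tG ds dt.
Qed.

End Product.

Definition nae (n : nat) : cnf n :=
  [seq [seq (i, b) | i <- enum 'I_n] | b <- [:: true; false]].

Definition fixed_to (n : nat) (s : face n) (b : bool) : {set 'I_n} :=
  [set i | s i == Some b].

Lemma is_3cnf_nae n : (n <= 3)%N -> is_3cnf (nae n).
Proof. by move=> n3; rewrite /is_3cnf /= !size_map -enumT size_enum_ord n3. Qed.

Lemma sat_nae n (x : assignment n) : sat x (nae n) = [forall b, exists i, x i == b].
Proof.
have clauseE b : sat_clause x [seq (i, b) | i <- enum 'I_n] = [exists i, x i == b].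
  rewrite /sat_clause has_map; apply/hasP/existsP => -[i]; first by exists i.
  by exists i; rewrite ?mem_enum.
rewrite /sat /= !clauseE andbT; apply/andP/forallP => [[xt xf] [] // | x_onto].
by split; apply: x_onto.
Qed.

Lemma in_solution_complex_nae n (s : face n) :
  in_solution_complex (nae n) s = [forall b, fixed_to s b != set0].
Proof.
apply/forallP/forallP => [sP b | s_onto x].
  have := sP (corner (~~ b) s); rewrite corner_vertex sat_nae => /forallP/(_ b)/existsP[i].
  by rewrite ffunE => ib; apply/set0Pn; exists i; rewrite inE; case: (s i) b ib => [[]|] [].
apply/implyP => /forallP xs; rewrite sat_nae; apply/forallP => b.
have /set0Pn[i] := s_onto b; rewrite inE => /eqP si; apply/existsP; exists i.
by have := xs i; rewrite si => /eqP[->].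
Qed.

Lemma fdim_fixed_to n (s : face n) :
  (fdim s + #|fixed_to s true| + #|fixed_to s false|)%N = n.
Proof.
rewrite -[RHS]card_ord -cardsT /fdim !cards_sum_mem -!big_split.
by apply: eq_bigr => i _; rewrite !inE; case: (s i) => [[]|].
Qed.

Lemma fixed_to_free_at n (t : face n) i b : fixed_to (free_at t i) b = fixed_to t b :\ i.
Proof. by apply/setP => j; rewrite !inE ffunE; case: (j == i). Qed.

Lemma mem_coface_vars_nae n (t : face n) i b :
  in_solution_complex (nae n) t -> t i = Some b ->
  (i \in coface_vars (nae n) t) = (1 < #|fixed_to t b|)%N.
Proof.
rewrite inE !in_solution_complex_nae => /forallP t_onto ti; rewrite ti /=.
have tiE c : (i \in fixed_to t c) = (c == b) by rewrite inE ti eq_sym.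
transitivity (fixed_to t b :\ i != set0); last first.
  by rewrite -card_gt0 (cardsD1 i (fixed_to t b)) tiE eqxx.
apply/forallP/idP => [/(_ b)|bi c]; rewrite fixed_to_free_at //.
have [-> //|cb] := eqVneq c b.
by rewrite (setDidPl _) // disjoint_sym disjoints1 tiE.
Qed.

Lemma card_coface_vars_nae n (t : face n) : in_solution_complex (nae n) t ->
  #|coface_vars (nae n) t| =
  (\sum_(b : bool) #|fixed_to t b| * (1 < #|fixed_to t b|))%N.
Proof.
move=> tF; rewrite big_bool -!sum_nat_const.
rewrite 2!(big_mkcond (fun i => i \in _)) -big_split cards_sum_mem.
apply: eq_bigr => i _; case ti: (t i) => [b|]; last by rewrite !inE ti.
by rewrite (mem_coface_vars_nae tF ti) !inE ti; case: b {ti}; rewrite /= ?addn0.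
Qed.

Lemma mod2_closed_nae n : mod2_closed (nae n.+2) n.
Proof.
have fixed_gt0 (s : face n.+2) b :
    in_solution_complex (nae n.+2) s -> (0 < #|fixed_to s b|)%N.
  by rewrite in_solution_complex_nae card_gt0 => /forallP.
split=> [s sF | t tF].
  have := fdim_fixed_to s; have := fixed_gt0 s true sF; have := fixed_gt0 s false sF; lia.
(* A cell of dimension [n - 1] fixes three variables, two of them to the same
   value: precisely these two can be freed. *)
rewrite card_coface_vars_nae // big_bool.
have := fdim_fixed_to t; have := fixed_gt0 t true tF; have := fixed_gt0 t false tF.
move: #|fixed_to t false| #|fixed_to t true| => [|[|[|b]]] // [|[|[|a]]] // _ _; lia.
Qed.

Definition pole_face n (b : bool) : face n.+2 :=
  [ffun i => if i == ord0 then Some b else if i == ord_max then Some (~~ b) else None].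

Lemma fixed_to_pole_face n b c :
  fixed_to (pole_face n b) c = [set if b == c then ord0 else ord_max].
Proof.
apply/setP => i; rewrite !inE ffunE.
have [->|i0] := eqVneq i ord0; first by case: b c => [] [].
have [->|im] := eqVneq i ord_max; first by case: b c => [] []; rewrite /= ?eqxx.
by case: b c => [] [] /=; rewrite ?(negPf i0) ?(negPf im).
Qed.

Lemma pole_face_nae n b : in_solution_complex (nae n.+2) (pole_face n b).
Proof.
rewrite in_solution_complex_nae; apply/forallP => c.
by rewrite fixed_to_pole_face -card_gt0 cards1.
Qed.

Lemma fdim_pole_face n b : fdim (pole_face n b) = n.
Proof.
by have := fdim_fixed_to (pole_face n b); rewrite !fixed_to_pole_face !cards1; lia.
Qed.

Lemma splits_into_nae n : splits_into (nae n.+2) n 1.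
Proof. exact: splits_into1 (pole_face_nae n true) (fdim_pole_face n true). Qed.

Lemma splits_into_nae2 : splits_into (nae 2) 0 2.
Proof.
exists bool, (fun s => s ord0 == Some true); split; first exact: card_bool.
  move=> t i /(mod2_closed_nae 0).1; rewrite leqn0 cards_eq0 => /eqP/setP/(_ i).
  by rewrite !inE ffunE eqxx.
move=> b; exists (pole_face 0 b).
by rewrite pole_face_nae fdim_pole_face ffunE; case: b.
Qed.

Fixpoint tori (N : nat) : cnf (N * 2 + 6) :=
  if N is N'.+1 then cnf_prod (nae 2) (tori N') else cnf_prod (nae 3) (nae 3).

Lemma is_3cnf_tori N : is_3cnf (tori N).
Proof.
elim: N => [|N IHN].
  exact: (is_3cnf_prod (@is_3cnf_nae 3 isT) (@is_3cnf_nae 3 isT)).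
exact: (is_3cnf_prod (@is_3cnf_nae 2 isT) IHN).
Qed.

Lemma mod2_closed_tori N : mod2_closed (tori N) 2.
Proof.
elim: N => [|N IHN].
  exact: (mod2_closed_prod (mod2_closed_nae 1) (mod2_closed_nae 1)).
exact: (mod2_closed_prod (mod2_closed_nae 0) IHN).
Qed.

Lemma splits_into_tori N : splits_into (tori N) 2 (2 ^ N).
Proof.
elim: N => [|N IHN].
  exact: (splits_into_prod (splits_into_nae 1) (splits_into_nae 1)).
by rewrite expnS; apply: (splits_into_prod splits_into_nae2 IHN).
Qed.

Lemma le_sqr_div_ln (R : realType) (x : R) : 1 < x -> x <= x ^+ 2 / ln x.
Proof.
move=> x_gt1; have x_gt0 : 0 < x by apply: lt_trans x_gt1.
rewrite ler_pdivlMr ?ln_gt0 // expr2 ler_pM2l //.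
exact/ltW/ln_sublinear.
Qed.

Theorem mainTheorem6 (R : realType) :
  exists (n : nat -> nat) (F : forall N : nat, cnf (n N)),
    [/\ forall N : nat, is_3cnf (F N),
        exists (C : R) (N0 : nat), 0 < C /\
          forall N : nat, (N0 <= N)%N ->
            (n N)%:R <= C * (N%:R ^+ 2 / ln (N%:R : R))
      & exists (c : R) (N0 : nat), 0 < c /\
          forall N : nat, (N0 <= N)%N ->
            2%:R `^ (c * N%:R) <= (betti (F N) 2)%:R].
Proof.
exists (fun N => N * 2 + 6)%N, tori; split; first exact: is_3cnf_tori.
  exists 5%:R, 2%N; split=> [|N N_ge2]; first by rewrite ltr0n.
  apply: (@le_trans _ _ (5%:R * N%:R)); first by rewrite -natrM ler_nat; lia.
  by rewrite ler_pM2l ?ltr0n // le_sqr_div_ln // ltr1n.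
exists 1, 0%N; split=> // N _; rewrite mul1r powR_mulrn // -natrX ler_nat.
exact: betti_ge_splits (mod2_closed_tori N) (splits_into_tori N).
Qed.
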